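(* Let $G$ be a $2$-edge-connected graph, let $C\in\mathrm{CP}(G)$, and let $G_1,\dots,G_r$ be the connected components of $G-C$ that contain at least one edge. Let $f\in C$ and $e_j\in E(G_j)$ for $j\in[r]$. Then the coparallel class inequality $$\sum_{j=1}^r x_{e_j}-(r-1)x_f\le 1$$ defines a facet of $\mathrm{TECSP}(G)$.
   Context: All graphs are finite, simple and undirected. For $\emptyset\subsetneq S\subsetneq V(G)$, $\delta(S)$ is the set of edges with exactly one endpoint in $S$ (a cut). An edge $e$ is a bridge if $\{e\}=\delta(S)$ for some $S$. A graph is $2$-edge-connected if it is connected and has no bridges; the empty graph and a single vertex are $2$-edge-connected. $\chi^H\in\{0,1\}^{E(G)}$ is the incidence vector of $E(H)$, and $\mathrm{TECSP}(G)=\mathrm{conv}\{\chi^H : H\subseteq G\text{ is }2\text{-edge-connected}\}\subseteq\mathbb{R}^{E(G)}$. Two distinct edges $e,f$ are coparallel if $\{e,f\}$ is an inclusion-wise minimal cut. A coparallel class is an inclusion-wise maximal set of non-bridge edges any two distinct elements of which are coparallel (a non-bridge edge in no $2$-cut forms a singleton class). $\mathrm{CP}(G)$ is the set of coparallel classes of $G$. $G-C$ denotes $G$ with the edges of $C$ deleted (all vertices kept). A facet is a face of dimension $\dim(\mathrm{TECSP}(G))-1$. *)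

(* Defs.v *)
From mathcomp Require Import all_boot all_order all_algebra.
Set Implicit Arguments. Unset Strict Implicit. Unset Printing Implicit Defensive.
Import Order.TTheory GRing.Theory Num.Theory.
Local Open Scope ring_scope.

(* A finite simple graph G: vertex type V, edge type Ed, and an injective
   map [ends] sending each edge to its 2-element set of endpoints.
   E(G) = Ed (all of it), V(G) = V (all of it). *)
Definition simple_graph (V Ed : finType) (ends : Ed -> {set V}) : Prop :=
  (forall e, #|ends e| = 2%N) /\ injective ends.

Definition adj (V Ed : finType) (ends : Ed -> {set V}) (F : {set Ed}) : rel V :=
  fun u v => [exists e in F, ends e == [set u; v]].

Definition subgraph (V Ed : finType) (ends : Ed -> {set V}) (W : {set V}) (F : {set Ed}) : Prop :=
  forall e, e \in F -> ends e \subset W.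

(* Connectedness of (W, F): any two vertices of W joined by a path of F-edges
   (vacuously true for the empty graph and a single vertex). *)
Definition connectedG (V Ed : finType) (ends : Ed -> {set V}) (W : {set V}) (F : {set Ed}) : Prop :=
  forall u v, u \in W -> v \in W -> connect (adj ends F) u v.

Definition cut (V Ed : finType) (ends : Ed -> {set V}) (F : {set Ed}) (S : {set V}) : {set Ed} :=
  [set e in F | #|ends e :&: S| == 1%N].

Definition bridge (V Ed : finType) (ends : Ed -> {set V}) (W : {set V}) (F : {set Ed}) (e : Ed) : Prop :=
  exists S : {set V}, [/\ S \subset W, S != set0, S != W & cut ends F S = [set e]].

Definition two_edge_connected (V Ed : finType) (ends : Ed -> {set V})
    (W : {set V}) (F : {set Ed}) : Prop :=
  connectedG ends W F /\ forall e, ~ bridge ends W F e.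

Definition is_cut (V Ed : finType) (ends : Ed -> {set V}) (D : {set Ed}) : Prop :=
  exists S : {set V}, [/\ S != set0, S != setT & D = cut ends setT S].

Definition minimal_cut (V Ed : finType) (ends : Ed -> {set V}) (D : {set Ed}) : Prop :=
  is_cut ends D /\ forall D', is_cut ends D' -> D' \subset D -> D' = D.

Definition coparallel (V Ed : finType) (ends : Ed -> {set V}) (e f : Ed) : Prop :=
  e != f /\ minimal_cut ends [set e; f].

Definition coparallel_set (V Ed : finType) (ends : Ed -> {set V}) (C : {set Ed}) : Prop :=
  (forall e, e \in C -> ~ bridge ends setT setT e) /\
  (forall e f, e \in C -> f \in C -> e != f -> coparallel ends e f).

Definition coparallel_class (V Ed : finType) (ends : Ed -> {set V}) (C : {set Ed}) : Prop :=
  coparallel_set ends C /\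
  forall C', coparallel_set ends C' -> C \subset C' -> C' = C.

Definition same_comp (V Ed : finType) (ends : Ed -> {set V}) (C : {set Ed}) (e t : Ed) : bool :=
  [exists u in ends e, exists v in ends t, connect (adj ends (~: C)) u v].

(* T = {e_1,...,e_r}: one edge from each connected component of G - C
   that contains at least one edge. *)
Definition comp_transversal (V Ed : finType) (ends : Ed -> {set V}) (C T : {set Ed}) : Prop :=
  T \subset ~: C /\
  forall e, e \notin C -> #|[set t in T | same_comp ends C e t]| = 1%N.

Definition incid (R : numDomainType) (Ed : finType) (F : {set Ed}) : {ffun Ed -> R} :=
  [ffun e => (e \in F)%:R].

Definition TECSP (R : numDomainType) (V Ed : finType) (ends : Ed -> {set V})
    (x : {ffun Ed -> R}) : Prop :=
  exists lam : {set Ed} -> R,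
    [/\ forall F, 0 <= lam F,
        forall F, lam F != 0 ->
          exists W : {set V}, subgraph ends W F /\ two_edge_connected ends W F,
        \sum_(F : {set Ed}) lam F = 1
      & forall e, x e = \sum_(F : {set Ed}) lam F * incid R F e].

Definition aff_indep_points (R : numDomainType) (Ed : finType)
    (S : {ffun Ed -> R} -> Prop) (m : nat) : Prop :=
  exists p : 'I_m -> {ffun Ed -> R},
    (forall i, S (p i)) /\
    forall c : 'I_m -> R, \sum_i c i = 0 -> (forall e, \sum_i c i * p i e = 0) -> forall i, c i = 0.

(* dim S = m - 1, i.e. the maximum number of affinely independent points of S is m. *)
Definition has_dim_plus1 (R : numDomainType) (Ed : finType)
    (S : {ffun Ed -> R} -> Prop) (m : nat) : Prop :=
  aff_indep_points S m /\ ~ aff_indep_points S m.+1.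

Definition defines_facet (R : numDomainType) (Ed : finType)
    (P : {ffun Ed -> R} -> Prop) (lhs : {ffun Ed -> R} -> R) (b : R) : Prop :=
  (forall x, P x -> lhs x <= b) /\
  exists k : nat, has_dim_plus1 P k.+1 /\
                  has_dim_plus1 (fun x => P x /\ lhs x = b) k.

(* Main.v *)
(* Every 2-edge-connected subgraph is a union of coparallel classes, and every
   component of G - A, for a coparallel class A, is 2-edge-connected.  The face
   spans a hyperplane that misses the origin, which is a vertex of the
   polytope, so it suffices that the points of the face span the incidence
   vector of every coparallel class.

   Besides G and the components G_j of G - C, the face contains, for each class
   B in G_j other than that of e_j, the component L_B of G - B that contains
   e_j: either L_B lies inside G_j, or it contains C and all the other G_i.  In
   both cases E(G_j) \ L_B is spanned, and it consists of B and of classes B'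
   with L_B strictly contained in L_B'.  Induction on the size of E(G_j) \ L_B
   therefore isolates the vector of B; the classes of e_j and of C are what
   remains in G_j and in G. *)
Require Import Defs.
From mathcomp Require Import all_boot all_order all_algebra.
Set Implicit Arguments. Unset Strict Implicit. Unset Printing Implicit Defensive.
Import Order.TTheory GRing.Theory Num.Theory.

(** * Crossing edges and reachability after deleting edges *)

Section Connectivity.
Variables (V Ed : finType) (ends : Ed -> {set V}).

Lemma adj_sym (F : {set Ed}) : symmetric (adj ends F).
Proof. by move=> u v; rewrite /adj setUC. Qed.

Lemma connect_adj_sym (F : {set Ed}) : connect_sym (adj ends F).
Proof. exact: sym_connect_sym (@adj_sym F). Qed.

(** Every edge of a path from [u] has an end already reached from [u], so [F'] need only contain the
    edges of [F] at reached vertices. This transfers reachability between graphs with different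
    deleted edges. *)
Lemma connect_adj_incident (F F' : {set Ed}) (u v : V) :
    (forall h w, h \in F -> w \in ends h -> connect (adj ends F) u w -> h \in F') ->
  connect (adj ends F) u v -> connect (adj ends F') u v.
Proof.
move=> sFF' /connectP[p + ->] {v}; elim/last_ind: p => [|p x IHp] //=.
rewrite rcons_path last_rcons => /andP[pp /existsP[h /andP[hF /eqP eh]]].
apply: connect_trans (IHp pp) (connect1 _).
apply/existsP; exists h; rewrite eh eqxx andbT.
apply: sFF' hF _ _; first by rewrite eh; apply: set21.
by apply/connectP; exists p.
Qed.

Definition crosses (S : {set V}) (e : Ed) : bool := #|ends e :&: S| == 1.

Lemma in_cut (F : {set Ed}) S e : (e \in cut ends F S) = (e \in F) && crosses S e.
Proof. by rewrite inE. Qed.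

(** Intended for [e] outside [A]: an edge of [A] may touch two components of G - A. *)
Definition comp_edges (A : {set Ed}) (e : Ed) : {set Ed} :=
  [set h | (h \notin A) && same_comp ends A e h].

Definition symdiff (S X : {set V}) : {set V} := [set v | (v \in S) (+) (v \in X)].

(** A reflexive Boolean form of [coparallel]. In a 2-edge-connected graph a two-edge cut is
    automatically minimal, see [cop_coparallel]. *)
Definition cop (a b : Ed) : bool :=
  (a == b) || [exists S, cut ends setT S == [set a; b]].

Definition cop_class (b : Ed) : {set Ed} := [set a | cop b a].

(** The vertex set is existential because the points of [TECSP] record edges only. *)
Definition tec_edges (F : {set Ed}) : Prop :=
  exists W, subgraph ends W F /\ two_edge_connected ends W F.

Lemma in_comp_edges A e h :
  (h \in comp_edges A e) = (h \notin A) && same_comp ends A e h.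
Proof. by rewrite inE. Qed.

Lemma in_cop_class b a : (a \in cop_class b) = cop b a.
Proof. by rewrite inE. Qed.

Lemma cop_refl : reflexive cop.
Proof. by move=> a; rewrite /cop eqxx. Qed.

Lemma cop_sym : symmetric cop.
Proof. by move=> a b; rewrite /cop eq_sym setUC. Qed.

Hypothesis card_ends : forall e, #|ends e| = 2.

Lemma endsP e : exists u v, u != v /\ ends e = [set u; v].
Proof.
by have /eqP/cards2P[u [v]] := card_ends e; exists u, v.
Qed.

Lemma crossesE (S : {set V}) e u v : u != v -> ends e = [set u; v] ->
  crosses S e = (u \in S) (+) (v \in S).
Proof.
move=> uv eE; rewrite /crosses eE setIUl cardsU.
have -> : [set u] :&: S :&: ([set v] :&: S) = set0.
  apply/setP=> x; rewrite !inE; case: (x =P u) => //= -> .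
  by rewrite (negPf uv) andbF.
rewrite cards0 subn0.
have c1 x : #|[set x] :&: S| = (x \in S).
  case: (boolP (x \in S)) => xS.
    by rewrite (setIidPl _) ?cards1 // sub1set.
  by apply/eqP; rewrite cards_eq0 setI_eq0 disjoints1.
by rewrite !c1; case: (u \in S); case: (v \in S).
Qed.

(** Addition in the cut space over the two-element field. *)
Lemma crosses_symdiff S X e :
  crosses (symdiff S X) e = crosses S e (+) crosses X e.
Proof.
have [u [v [uv eE]]] := endsP e.
rewrite !(crossesE _ uv eE) !inE.
by do 4!case: (_ \in _).
Qed.

Lemma crossesP (S : {set V}) e :
  reflect (exists u v, [/\ u \in ends e, v \in ends e, u \in S & v \notin S])
    (crosses S e).
Proof.
apply: (iffP idP); have [u [v [uv eE]]] := endsP e; rewrite (crossesE _ uv eE) eE.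
  case: (boolP (u \in S)) => uS; case: (boolP (v \in S)) => vS //= _.
    by exists u, v; rewrite set21 set22.
  by exists v, u; rewrite set21 set22.
move=> [x [y]]; rewrite !inE => -[/orP[]/eqP-> /orP[]/eqP->].
all: by do 2!case: (_ \in S).
Qed.

Lemma adj_ends (F : {set Ed}) h u v : h \in F -> u \in ends h -> v \in ends h ->
  connect (adj ends F) u v.
Proof.
move=> hF; have [x [y [xy eE]]] := endsP h; rewrite eE.
have cxy : connect (adj ends F) x y.
  by apply: connect1; apply/existsP; exists h; rewrite hF eE eqxx.
by rewrite !inE => /orP[]/eqP-> /orP[]/eqP->; rewrite // connect_adj_sym.
Qed.

Lemma ends_neq0 e : exists u, u \in ends e.
Proof. by have [u [v [_ ->]]] := endsP e; exists u; apply: set21. Qed.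

Lemma same_compE (A : {set Ed}) e h u v : e \notin A -> h \notin A ->
  u \in ends e -> v \in ends h ->
  same_comp ends A e h = connect (adj ends (~: A)) u v.
Proof.
move=> eA hA ue vh; apply/existsP/idP => [[x /andP[xe /existsP[y /andP[yh xy]]]]|uv].
  apply: connect_trans (connect_trans xy _).
    by apply: (@adj_ends _ e); rewrite ?inE.
  by apply: (@adj_ends _ h); rewrite ?inE.
by exists u; rewrite ue /=; apply/existsP; exists v; rewrite vh.
Qed.

Lemma same_comp_sym (A : {set Ed}) e h : same_comp ends A e h = same_comp ends A h e.
Proof.
by apply/existsP/existsP => [] [x /andP[xe /existsP[y /andP[yh xy]]]];
  exists y; rewrite yh /=; apply/existsP; exists x; rewrite xe connect_adj_sym.
Qed.

Lemma same_comp_refl (A : {set Ed}) e : same_comp ends A e e.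
Proof.
have [u ue] := ends_neq0 e.
by apply/existsP; exists u; rewrite ue; apply/existsP; exists u; rewrite ue connect0.
Qed.

Lemma same_comp_trans (A : {set Ed}) e h g : h \notin A ->
  same_comp ends A e h -> same_comp ends A h g -> same_comp ends A e g.
Proof.
move=> hA /existsP[x /andP[xe /existsP[y /andP[yh xy]]]].
move=> /existsP[x' /andP[x'e /existsP[y' /andP[y'h xy']]]].
apply/existsP; exists x; rewrite xe; apply/existsP; exists y'; rewrite y'h /=.
apply: connect_trans (connect_trans xy _) xy'.
by apply: (@adj_ends _ h); rewrite ?inE.
Qed.

(** * Coparallelism in a 2-edge-connected graph *)

Hypothesis tecG : two_edge_connected ends setT setT.

Lemma cut_neq0 (S : {set V}) : S != set0 -> S != setT -> exists a, crosses S a.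
Proof.
move=> /set0Pn[u uS] ST.
have [v vS] : exists v, v \notin S.
  apply/existsP; rewrite -negb_forall; apply: contra ST => /forallP aS.
  by apply/eqP/setP=> x; rewrite aS inE.
case: (boolP [exists a, crosses S a]) => [/existsP//|/existsPn nc].
have cl : closed (adj ends setT) (mem S).
  move=> x y /existsP[h /andP[_ /eqP eh]].
  apply/idP/idP => H; apply: contraNT (nc h) => H'; apply/crossesP.
    by exists x, y; rewrite eh set21 set22.
  by exists y, x; rewrite eh set21 set22.
have := closed_connect cl (tecG.1 u v (in_setT _) (in_setT _)).
by rewrite /= uS (negPf vS).
Qed.

Lemma no_bridge_cut (S : {set V}) e : cut ends setT S != [set e].
Proof.
apply/eqP => cS; apply: (tecG.2 e); exists S.
have: e \in cut ends setT S by rewrite cS set11.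
rewrite in_cut inE /= => /crossesP[u [v [_ _ uS vS]]]; split=> //.
- by apply/set0Pn; exists u.
- by apply: contraNneq vS => ->.
Qed.

(** The cuts {a, b} and {b, c} add up to the cut {a, c} in the cut space. *)
Lemma cop_trans : transitive cop.
Proof.
move=> b a c; rewrite /cop.
case: (eqVneq a b) => [-> //|ab] /= /existsP[S1 /eqP c1].
case: (eqVneq b c) => [<-|bc] /=.
  by rewrite (introT existsP) ?orbT //; exists S1; rewrite c1.
move=> /existsP[S2 /eqP c2]; case: (eqVneq a c) => //= ac.
apply/existsP; exists (symdiff S1 S2); apply/eqP/setP => e.
move: c1 c2 => /setP/(_ e) + /setP/(_ e).
rewrite !in_cut !inE /= crosses_symdiff => -> ->.
case: (eqVneq e b) => [->|eb]; first by rewrite !orbT /= eq_sym (negPf ab) (negPf bc).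
by case: (eqVneq e a) => [->|ea] /=; rewrite ?(negPf ac).
Qed.

(* Replacing [S] by its symmetric difference with a 2-cut contained in the
   class removes two class edges from the cut of [S]; what remains in the end
   is a bridge or a 2-cut through [g]. *)
Lemma cop_class_cut (S : {set V}) b g : crosses S g ->
  cut ends setT S \subset g |: cop_class b -> cop b g.
Proof.
move: {-1}(#|cut ends setT S|) (leqnn #|cut ends setT S|) => n.
elim: n S => [|n IHn] S leS gS sS.
  by move: leS; rewrite leqn0 cards_eq0 => /eqP/setP/(_ g); rewrite in_cut !inE gS.
have gc : g \in cut ends setT S by rewrite in_cut inE.
have mem_cls a : a \in cut ends setT S -> a != g -> cop b a.
  by move=> /(subsetP sS); rewrite !inE => /orP[->|].
case: (set_0Vmem (cut ends setT S :\ g)) => [c0|[a]].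
  have := no_bridge_cut S g; rewrite -(setD1K gc) c0 setU0 eqxx //.
rewrite in_setD1 => /andP[ag ac].
have ba := mem_cls a ac ag.
case: (set_0Vmem (cut ends setT S :\ g :\ a)) => [c0|[a']].
  apply: cop_trans ba _; rewrite cop_sym /cop (introT existsP) ?orbT //; exists S.
  by rewrite -(setD1K gc) -(@setD1K _ a (_ :\ g)) ?c0 ?setU0 // in_setD1 ag.
rewrite !in_setD1 => /and3P[a'a a'g a'c].
have /orP[/eqP aa'|/existsP[X /eqP cX]] : cop a a'.
  by apply: cop_trans (mem_cls a' a'c a'g); rewrite cop_sym.
  by rewrite aa' eqxx in a'a.
have crX e : crosses X e = (e == a) || (e == a').
  by move/setP: cX => /(_ e); rewrite in_cut !inE.
have cS' : cut ends setT (symdiff S X) = cut ends setT S :\ a :\ a'.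
  apply/setP=> e; rewrite in_cut !in_setD1 inE /= crosses_symdiff crX in_cut inE /=.
  move: ac a'c; rewrite !in_cut !inE /=.
  case: (eqVneq e a) => [->|ea] /=; first by move=> ->; rewrite andbF.
  case: (eqVneq e a') => [->|ea'] /=; first by move=> _ ->.
  by rewrite addbF.
apply: (IHn (symdiff S X)).
- rewrite cS' -ltnS; apply: leq_trans leS; apply: proper_card.
  apply: (sub_proper_trans (B := pred_of_set (cut ends setT S :\ a))); first exact: subsetDl.
  exact: properD1.
- by rewrite crosses_symdiff gS crX eq_sym (negPf ag) eq_sym (negPf a'g).
- by rewrite cS'; apply: subset_trans sS; apply: subset_trans (subsetDl _ _) (subsetDl _ _).
Qed.

(** A 2-cut of G restricts to a cut of the subgraph; if only one of its two edges survived there,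
    that edge would be a bridge. *)
Lemma tec_edges_cop F a b : tec_edges F -> cop a b -> a \in F -> b \in F.
Proof.
move=> [W [sW [_ nb]]] /orP[/eqP<- //|/existsP[S /eqP cS]] aF.
(* A bridge needs a side inside [W]. Edges of [F] have both ends in [W], so intersecting with [W]
   changes none of their crossings. *)
apply: contraT => bF; exfalso; apply: (nb a); exists (S :&: W).
have crS e : crosses S e = (e == a) || (e == b).
  by move/setP: cS => /(_ e); rewrite in_cut !inE.
have /crossesP[u [v [ua va uS vS]]] : crosses S a by rewrite crS eqxx.
have uW := subsetP (sW a aF) u ua; have vW := subsetP (sW a aF) v va.
split; first exact: subsetIr.
- by apply/set0Pn; exists u; rewrite inE uS.
- by apply/eqP => /setP/(_ v); rewrite inE vW (negPf vS).
apply/setP => e; rewrite in_cut !inE.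
case: (boolP (e \in F)) => eF /=; last by apply/esym/negbTE; apply: contraNneq eF => ->.
have -> : crosses (S :&: W) e = crosses S e.
  by rewrite /crosses setIA setIAC (setIidPl (sW e eF)).
rewrite crS; case: (eqVneq e b) => [eb|_]; last by rewrite orbF.
by rewrite -eb eF in bF.
Qed.

(** A side [S] of a bridge [g] of the component is crossed in G only by [g] and by deleted class
    edges. Then [cop_class_cut] puts [g] in the deleted class, a contradiction. *)
Lemma comp_edges_tec b e : ~~ cop b e -> tec_edges (comp_edges (cop_class b) e).
Proof.
move=> be; set A := cop_class b.
have eA : e \notin A by rewrite in_cop_class.
have [u ue] := ends_neq0 e.
pose W := [set v | connect (adj ends (~: A)) u v].
have incW h v : h \notin A -> v \in ends h -> v \in W -> h \in comp_edges A e.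
  by move=> hA vh; rewrite in_comp_edges hA inE (same_compE eA hA ue vh).
have sW : subgraph ends W (comp_edges A e).
  move=> h; rewrite in_comp_edges => /andP[hA eh]; apply/subsetP=> v vh.
  by rewrite inE -(same_compE eA hA ue vh).
exists W; split=> //; split.
  have cW v : v \in W -> connect (adj ends (comp_edges A e)) u v.
    rewrite inE; apply: connect_adj_incident => h w; rewrite inE => hA wh uw.
    by apply: (incW h w) => //; rewrite inE.
  move=> x y /cW ux /cW; apply: connect_trans; by rewrite connect_adj_sym.
move=> g [S [SW S0 SnW cS]].
have : g \in cut ends (comp_edges A e) S by rewrite cS set11.
rewrite in_cut in_comp_edges => /andP[/andP[gA _] gS].
move/negP: gA; apply; rewrite in_cop_class.
apply: cop_class_cut gS _; apply/subsetP => h; rewrite in_cut inE /= => hS.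
rewrite in_setU1; case: (boolP (h \in cop_class b)) => hA; rewrite ?orbT //.
rewrite -in_set1 -cS in_cut hS andbT orbF.
have /crossesP[v [_ [vh _ vS _]]] := hS.
by apply: incW hA vh _; apply: subsetP SW _ vS.
Qed.

(** The vertices reached from [u] form a nonempty proper subset, so some edge of G leaves it, and
    such an edge must have been deleted. *)
Lemma reach_removed (A : {set Ed}) u x : ~~ connect (adj ends (~: A)) u x ->
  exists2 a, a \in A & exists2 v, v \in ends a & connect (adj ends (~: A)) u v.
Proof.
move=> nux; pose S := [set v | connect (adj ends (~: A)) u v].
have [||a /crossesP[v [w [va wa vS wS]]]] := @cut_neq0 S.
- by apply/set0Pn; exists u; rewrite inE connect0.
- by apply: contraNneq nux => /setP/(_ x); rewrite !inE.
move: vS wS; rewrite !inE => vS wS.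
exists a; last by exists v.
apply: contraNT wS => aA; apply: connect_trans vS _.
by apply: (@adj_ends _ a); rewrite ?inE.
Qed.

(** * Coparallel classes as equivalence classes of [cop] *)

Lemma coparallel_cop a b : coparallel ends a b -> cop a b.
Proof.
move=> [_ [[S [_ _ cS]] _]]; apply/orP; right; apply/existsP; exists S.
by rewrite cS.
Qed.

(** A cut properly contained in {a, b} would be empty, against connectedness, or a single edge,
    hence a bridge. *)
Lemma cop_coparallel a b : a != b -> cop a b -> coparallel ends a b.
Proof.
move=> ab; rewrite /cop (negPf ab) /= => /existsP[S /eqP cS]; split=> //; split.
  exists S; have : a \in cut ends setT S by rewrite cS set21.
  rewrite in_cut inE /= => /crossesP[u [v [_ _ uS vS]]].
  split=> //; first by apply/set0Pn; exists u.
  by apply: contraNneq vS => ->.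
move=> D [X [X0 XT ->]] sX.
have [d dX] := cut_neq0 X0 XT.
have dD : d \in cut ends setT X by rewrite in_cut inE.
apply/eqP; rewrite eqEsubset sX /=; apply/subsetP => c; rewrite in_set2 => cab.
apply: contraT => cX.
have := no_bridge_cut X d; rewrite eqEsubset sub1set dD andbT; case/negP.
apply/subsetP => h hD; rewrite in_set1; apply: contraNT cX => hd.
suff /orP[] : (c == h) || (c == d) by move=> /eqP->.
move: (subsetP sX _ dD) (subsetP sX _ hD) hd; rewrite !in_set2.
case/orP: cab => /eqP-> /orP[] /eqP-> /orP[] /eqP->; rewrite ?eqxx ?orbT //.
Qed.

Lemma cop_class_set b : coparallel_set ends (cop_class b).
Proof.
split=> [e _|e f]; first exact: tecG.2.
rewrite !in_cop_class => be bf ef; apply: cop_coparallel => //.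
by apply: cop_trans bf; rewrite cop_sym.
Qed.

Lemma coparallel_classE C f : coparallel_class ends C -> f \in C -> C = cop_class f.
Proof.
move=> [[_ Ccop] Cmax] fC; apply/esym/Cmax; first exact: cop_class_set.
apply/subsetP => e eC; rewrite in_cop_class.
case: (eqVneq f e) => [->|fe]; first exact: cop_refl.
exact: coparallel_cop (Ccop _ _ fC eC fe).
Qed.

(** * Comparing the components left by different classes *)

Lemma tec_edges_same_comp (A F : {set Ed}) e h : tec_edges F ->
  {in F, forall g, g \notin A} -> e \in F -> h \in F -> same_comp ends A e h.
Proof.
move=> [W [sW [cW _]]] FA eF hF.
have [[u ue] [v vh]] := (ends_neq0 e, ends_neq0 h).
rewrite (same_compE (FA _ eF) (FA _ hF) ue vh).
apply: connect_adj_incident (cW u v _ _) => [g w gF _ _||].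
- by rewrite inE FA.
- exact: subsetP (sW e eF) u ue.
- exact: subsetP (sW h hF) v vh.
Qed.

Lemma tec_edges_avoid F a b : tec_edges F -> a \notin F -> b \in F -> ~~ cop a b.
Proof.
move=> tF aF bF; apply: contra aF => ab; apply: tec_edges_cop tF _ bF.
by rewrite cop_sym.
Qed.

Lemma mem_comp_edges (A : {set Ed}) e : e \notin A -> e \in comp_edges A e.
Proof. by move=> eA; rewrite in_comp_edges eA same_comp_refl. Qed.

(** Missing [b], the subgraph misses the whole class of [b], so it stays connected after that class
    is deleted. *)
Lemma sub_comp_edges b e F : tec_edges F -> b \notin F -> e \in F ->
  F \subset comp_edges (cop_class b) e.
Proof.
move=> tF bF eF.
have FA : {in F, forall g, g \notin cop_class b}.
  by move=> g gF; rewrite in_cop_class; apply: tec_edges_avoid gF.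
by apply/subsetP => h hF; rewrite in_comp_edges FA //=; apply: tec_edges_same_comp FA _ _.
Qed.

(* The component of [e] in [G - cop_class b] is attached to an edge of that
   class, and it survives in [G - cop_class b'], so it grows there. *)
Lemma comp_edges_grow e b b' : ~~ cop b e -> ~~ cop b b' ->
  b' \notin comp_edges (cop_class b) e -> b \in comp_edges (cop_class b') e.
Proof.
move=> be bb' b'L.
have tL := comp_edges_tec be.
have eL : e \in comp_edges (cop_class b) e by rewrite mem_comp_edges ?in_cop_class.
have b'e : ~~ cop b' e by apply: tec_edges_avoid eL.
have [[u ue] [v vb']] := (ends_neq0 e, ends_neq0 b').
have eA : e \notin cop_class b by rewrite in_cop_class.
have nuv : ~~ connect (adj ends (~: cop_class b)) u v.
  apply: contra b'L => uv; rewrite in_comp_edges in_cop_class bb' /=.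
  by rewrite (same_compE eA _ ue vb') // in_cop_class.
have [a ba [w wa uw]] := reach_removed nuv.
rewrite in_cop_class in ba.
have b'a : ~~ cop b' a.
  by apply: contra bb' => b'a; apply: cop_trans ba _; rewrite cop_sym.
apply: tec_edges_cop (comp_edges_tec b'e) (_ : cop a b) _; first by rewrite cop_sym.
rewrite -in_cop_class in b'e; rewrite -in_cop_class in b'a.
rewrite in_comp_edges b'a (same_compE b'e b'a ue wa) /=.
apply: connect_adj_incident uw => g x; rewrite inE => gA xg ux.
rewrite inE in_cop_class; apply: tec_edges_avoid tL b'L _.
by rewrite in_comp_edges gA (same_compE eA gA ue xg).
Qed.

(** This treats an L_b that leaves the component of [t] in G - C, where C is the class of [f]. If
    [h] is not itself in the class of [b], a walk from [h] in G - [cop_class b] reaches an edge [a]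
    of that class. The walk stays away from L_b, which contains the class of [f], so it survives in
    G - C and joins [h] to [a], hence to [t]. *)
Lemma comp_edges_outside f b t h : ~~ cop b t -> ~~ cop f t ->
  b \in comp_edges (cop_class f) t -> f \in comp_edges (cop_class b) t ->
  h \notin comp_edges (cop_class b) t -> h \in comp_edges (cop_class f) t.
Proof.
move=> bt ft bL fL hL.
have tL := comp_edges_tec bt; have tL' := comp_edges_tec ft.
case: (boolP (cop b h)) => bh; first exact: tec_edges_cop tL' bh bL.
have [[x xt] [u uh]] := (ends_neq0 t, ends_neq0 h).
have tA : t \notin cop_class b by rewrite in_cop_class.
have hA : h \notin cop_class b by rewrite in_cop_class.
have nux : ~~ connect (adj ends (~: cop_class b)) u x.
  apply: contra hL => ux; rewrite in_comp_edges hA (same_compE tA hA xt uh).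
  by rewrite connect_adj_sym.
have [a ba [w wa uw]] := reach_removed nux.
rewrite in_cop_class in ba.
have aL := tec_edges_cop tL' ba bL.
have hC : h \notin cop_class f.
  by rewrite in_cop_class cop_sym; apply: tec_edges_avoid tL hL fL.
move: aL; rewrite !in_comp_edges hC => /andP[aC ta] /=.
apply: same_comp_trans (aC) ta _; rewrite same_comp_sym (same_compE hC aC uh wa).
apply: connect_adj_incident uw => g y; rewrite inE => gA yg uy.
(* An edge of the class of [f] met by the walk would lie in L_b and so connect [u] to [x]. *)
rewrite inE in_cop_class; apply: contra nux => fg.
have : g \in comp_edges (cop_class b) t by apply: tec_edges_cop fg fL.
rewrite in_comp_edges gA (same_compE tA gA xt yg) /= => xy.
by apply: connect_trans uy _; rewrite connect_adj_sym.
Qed.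

End Connectivity.
Local Open Scope ring_scope.

(** * Affine dimension from linear rank *)

Section Dimension.
Variables (R : realFieldType) (Ed : finType).

Definition rowv (x : {ffun Ed -> R}) : 'rV[R]_#|Ed| := \row_i x (enum_val i).

Definition incid_mx (FF : {set {set Ed}}) : 'M[R]_(#|FF|, #|Ed|) :=
  \matrix_(i < #|FF|) rowv (incid R (enum_val i)).

Lemma rowv_incid_sub (FF : {set {set Ed}}) F : F \in FF ->
  (rowv (incid R F) <= incid_mx FF)%MS.
Proof.
move=> FFF; apply: (eq_row_sub (enum_rank_in FFF F)).
by rewrite rowK enum_rankK_in.
Qed.

Lemma indep_points_rank m k (M : 'M[R]_(k, #|Ed|)) (p : 'I_m -> {ffun Ed -> R}) :
    (forall i, (rowv (p i) <= M)%MS) ->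
    (forall c : 'I_m -> R, (forall e, \sum_i c i * p i e = 0) -> forall i, c i = 0) ->
  (m <= \rank M)%N.
Proof.
move=> pM pfree; pose A := \matrix_(i < m) rowv (p i).
have sAM : (A <= M)%MS by apply/row_subP => i; rewrite rowK.
suff /eqP <- : row_free A by apply: mxrankS.
apply/inj_row_free => v vA; apply/rowP => i; rewrite [RHS]mxE.
apply: (pfree (fun i => v 0 i)) => e.
move/rowP: vA => /(_ (enum_rank e)); rewrite !mxE => vA.
by rewrite -[RHS]vA; apply: eq_bigr => j _; rewrite !mxE enum_rankK.
Qed.

(** With k the rank of the face vectors, k independent ones lie on the face, and the origin adds one
    more affinely independent point of [P]. Both numbers are maximal because all of [P] lies in a
    space of dimension k. *)
Lemma defines_facet_of_span (P : {ffun Ed -> R} -> Prop) (lhs : {ffun Ed -> R} -> R)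
    (w : Ed -> R) (FF : {set {set Ed}}) :
    (forall x, lhs x = \sum_e w e * x e) ->
    (forall x, P x -> lhs x <= 1) ->
    P 0 ->
    (forall F, F \in FF -> P (incid R F) /\ lhs (incid R F) = 1) ->
    (forall x, P x -> (rowv x <= incid_mx FF)%MS) ->
  defines_facet P lhs 1.
Proof.
move=> lhsE valid P0 face span; split=> //.
(* On the hyperplane where [lhs] is 1, every linear relation is affine: applying [lhs] to it shows
   that its coefficients sum to 0. *)
have lhs_sum m (c : 'I_m -> R) (p : 'I_m -> {ffun Ed -> R}) :
    (forall i, lhs (p i) = 1) -> (forall e, \sum_i c i * p i e = 0) -> \sum_i c i = 0.
  move=> lp cp; transitivity (\sum_i c i * lhs (p i)).
    by apply: eq_bigr => i _; rewrite lp mulr1.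
  under eq_bigr => i _ do rewrite lhsE mulr_sumr.
  rewrite exchange_big big1 //= => e _.
  transitivity (w e * \sum_i c i * p i e); last by rewrite cp mulr0.
  by rewrite mulr_sumr; apply: eq_bigr => i _; rewrite mulrCA.
pose M := incid_mx FF; pose k := \rank M.
pose p (i : 'I_k) := incid R (enum_val (maxrankfun M i)).
have pface i : P (p i) /\ lhs (p i) = 1 by apply: face; apply: enum_valP.
have pfree (c : 'I_k -> R) : (forall e, \sum_i c i * p i e = 0) -> forall i, c i = 0.
  move=> cp i; have /row_free_inj inj := maxrowsub_free M.
  have : (\row_i c i) *m rowsub (maxrankfun M) M = 0 *m rowsub (maxrankfun M) M.
    rewrite mul0mx; apply/rowP => j; rewrite !mxE -[RHS](cp (enum_val j)).
    by apply: eq_bigr => l _; rewrite !mxE.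
  by move/inj/rowP/(_ i); rewrite !mxE.
exists k; split; split.
(* Index 0 carries the origin. The other coefficients vanish by [pfree], then the first one because
   the sum is 0. *)
- exists (fun i => if unlift ord0 i is Some j then p j else 0); split.
    by move=> i; case: unliftP => [j|] _ //; case: (pface j).
  move=> c c0 cp.
  have cl j : c (lift ord0 j) = 0.
    apply: (pfree (fun j => c (lift ord0 j))) => e; rewrite -[RHS](cp e).
    rewrite big_ord_recl unlift_none ffunE mulr0 add0r.
    by apply: eq_bigr => i _; rewrite liftK.
  move=> i; case: (unliftP ord0 i) => [j|] -> //.
  by move: c0; rewrite big_ord_recl big1 ?addr0.
- move=> [q [qP qfree]].
  (* Subtracting [q ord0] turns k + 2 affinely independent points into k + 1 linearly independent
     vectors. *)
  have := @indep_points_rank k.+1 _ M (fun i => q (lift ord0 i) - q ord0).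
  rewrite -/k ltnn => H; suff: false by []; apply: H.
    move=> i.
    have -> : rowv (q (lift ord0 i) - q ord0) = rowv (q (lift ord0 i)) - rowv (q ord0).
      by apply/rowP => j; rewrite !mxE !ffunE.
    by rewrite addmx_sub ?eqmx_opp //; apply: span.
  move=> c cq i.
  (* The coefficient of [q ord0] is chosen so that all coefficients sum to 0. *)
  pose d (j : 'I_k.+2) := if unlift ord0 j is Some l then c l else - \sum_l c l.
  have dE : \sum_j d j = 0.
    rewrite big_ord_recl {1}/d unlift_none.
    by under [X in _ + X]eq_bigr => l _ do rewrite /d liftK; rewrite addNr.
  have := qfree d dE _ (lift ord0 i); rewrite {2}/d liftK; apply=> e.
  rewrite big_ord_recl {1}/d unlift_none -[RHS](cq e).
  under [X in _ + X]eq_bigr => l _ do rewrite /d liftK.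
  under [RHS]eq_bigr => l _ do rewrite !ffunE mulrBr.
  by rewrite sumrB mulNr mulr_suml addrC.
- by exists p; split=> // c _; apply: pfree.
- move=> [q [qP qfree]].
  have := @indep_points_rank k.+1 _ M q; rewrite -/k ltnn => H.
  suff: false by []; apply: H => [i|c cq]; first by apply: span; case: (qP i).
  by apply: qfree => //; apply: lhs_sum cq => i; case: (qP i).
Qed.

End Dimension.

(** * Subgraphs on the face *)

Section Face.
Variables (R : realFieldType) (V Ed : finType) (ends : Ed -> {set V}).
Hypothesis card_ends : forall e, #|ends e| = 2%N.
Hypothesis tecG : two_edge_connected ends setT setT.
Variables (C T : {set Ed}) (f : Ed).
Hypothesis CE : C = cop_class ends f.
Hypothesis transT : comp_transversal ends C T.

Local Notation cop := (cop ends).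
Local Notation cls := (cop_class ends).
Local Notation comp := (comp_edges ends).
Local Notation tec := (tec_edges ends).

Definition face_value (x : {ffun Ed -> R}) : R :=
  \sum_(t in T) x t - (#|T|%:R - 1) * x f.

(** Taking [b] in [C] gives the components G_j, since its class is then [C]; taking [b] in
    [comp C t] gives the sets L_B. *)
Definition face_sets : {set {set Ed}} :=
  setT |: [set F | [exists t in T, exists b, [&& ~~ cop b t,
     (b \in C) || (b \in comp C t) & F == comp (cls b) t]]].

Lemma transversal_inj t t' : t \in T -> t' \in T -> same_comp ends C t t' -> t = t'.
Proof.
move=> tT t'T tt'; have tC : t \notin C by have := subsetP transT.1 t tT; rewrite inE.
have /eqP/cards1P[x xE] := transT.2 t tC.
have : t \in [set t0 in T | same_comp ends C t t0] by rewrite inE tT same_comp_refl.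
have : t' \in [set t0 in T | same_comp ends C t t0] by rewrite inE t'T.
by rewrite xE !inE => /eqP-> /eqP->.
Qed.

Lemma transversal_notin t : t \in T -> ~~ cop f t.
Proof. by move=> /(subsetP transT.1); rewrite inE CE in_cop_class. Qed.

Lemma face_value_incid F :
  face_value (incid R F) = #|T :&: F|%:R - (#|T|%:R - 1) * (f \in F)%:R.
Proof.
rewrite /face_value ffunE; congr (_ - _).
rewrite -[in RHS]sum1_card natr_sum.
transitivity (\sum_(t in T) (t \in F)%:R : R).
  by apply: eq_bigr => t _; rewrite ffunE.
rewrite [RHS](eq_bigl (fun t => (t \in T) && (t \in F))); last by move=> t; rewrite inE.
by rewrite big_mkcondr; apply: eq_bigr => t _; case: (t \in F).
Qed.

(** If [f] is in [F], the value is at most #|T| - (#|T| - 1). Otherwise [F] misses all of [C], so it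
    lies in one component of G - C and meets [T] at most once. *)
Lemma face_value_le F : tec F -> face_value (incid R F) <= 1.
Proof.
move=> tF; rewrite face_value_incid; case: (boolP (f \in F)) => fF.
  by rewrite mulr1 opprB addrCA gerDl subr_le0 ler_nat subset_leq_card ?subsetIl.
rewrite mulr0 subr0 (ler_nat _ _ 1); apply/card_le1_eqP => t t'.
rewrite !inE => /andP[tT tF'] /andP[t'T t'F].
apply: transversal_inj => //; apply: tec_edges_same_comp (tF) _ _ _ => // g gF.
by rewrite CE in_cop_class; apply: tec_edges_avoid gF.
Qed.

Lemma face_sets_tec F : F \in face_sets -> tec F.
Proof.
rewrite in_setU1 => /orP[/eqP->|]; first by exists setT; split.
rewrite inE => /existsP[t /andP[tT /existsP[b /and3P[bt _ /eqP->]]]].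
exact: comp_edges_tec.
Qed.

(** Without [f], the set lies in the component of [t] in G - C and meets [T] in [t] alone. With [f],
    it contains all of [T]. *)
Lemma face_sets_value F : F \in face_sets -> face_value (incid R F) = 1.
Proof.
move=> Fface; have tF := face_sets_tec Fface; rewrite face_value_incid.
have sTF : f \in F -> T \subset F ->
    #|T :&: F|%:R - (#|T|%:R - 1) * (f \in F)%:R = 1 :> R.
  by move=> -> /setIidPl->; rewrite mulr1 opprB addrC subrK.
move: Fface; rewrite in_setU1 => /orP[/eqP FE|].
  by apply: sTF; rewrite FE ?subsetT.
rewrite inE => /existsP[t /andP[tT /existsP[b /and3P[bt bCt /eqP FE]]]].
have tinF : t \in F by rewrite FE mem_comp_edges ?in_cop_class.
case: (boolP (f \in F)) sTF => fF; last first.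
  move=> _; rewrite mulr0 subr0; suff -> : T :&: F = [set t] by rewrite cards1.
  apply/eqP; rewrite eqEsubset sub1set inE tT tinF !andbT; apply/subsetP => t'.
  rewrite !inE => /andP[t'T t'F]; rewrite eq_sym; apply/eqP/transversal_inj => //.
  have := subsetP (sub_comp_edges card_ends tF fF tinF) t' t'F.
  by rewrite -CE in_comp_edges => /andP[].
(* Since [F] contains [f], [b] is not in [C]. An element [t'] missed by [F] would lie in the
   component of [t] in G - C, forcing [t' = t], which [F] contains. *)
apply=> //; apply/subsetP => t' t'T; apply: contraT => t'F.
have bC : b \in comp (cls f) t.
  case/orP: bCt; rewrite CE // in_cop_class => fb.
  by move: fF; rewrite FE in_comp_edges in_cop_class cop_sym fb.
rewrite FE in fF t'F.
have := comp_edges_outside card_ends tecG bt (transversal_notin tT) bC fF t'F.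
rewrite -CE in_comp_edges => /andP[_ tt'].
by move: t'F; rewrite -(transversal_inj tT t'T tt') mem_comp_edges ?in_cop_class.
Qed.

Lemma TECSP_incid F : tec F -> TECSP ends (incid R F).
Proof.
move=> tF; exists (fun F' => (F' == F)%:R); split.
- by move=> F'; rewrite ler0n.
- by move=> F'; rewrite pnatr_eq0 eqb0 negbK => /eqP->.
- by rewrite (bigD1 F) //= eqxx big1 ?addr0 // => F' /negPf->.
- move=> e; rewrite (bigD1 F) //= eqxx mul1r big1 ?addr0 // => F' /negPf->.
  by rewrite mul0r.
Qed.

(** * The linear span of the face *)

Local Notation spanned F := (rowv (incid R F) <= incid_mx R face_sets)%MS.

Lemma rowv_incidD (A B : {set Ed}) : A \subset B ->
  rowv (incid R B) = rowv (incid R A) + rowv (incid R (B :\: A)).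
Proof.
move=> /subsetP sAB; apply/rowP => i; rewrite !mxE !ffunE !inE.
move: (sAB (enum_val i)); case: (_ \in A) => [->//|_] /=; first by rewrite addr0.
by rewrite add0r.
Qed.

Lemma spannedD (A B : {set Ed}) : A \subset B -> spanned B -> spanned A -> spanned (B :\: A).
Proof.
move=> sAB sB sA.
have -> : rowv (incid R (B :\: A)) = rowv (incid R B) - rowv (incid R A).
  by rewrite (rowv_incidD sAB) addrC addKr.
by rewrite addmx_sub ?eqmx_opp.
Qed.

(** One class is split off at a time; what remains is still closed under [cop]. *)
Lemma spanned_cop_closed (F : {set Ed}) :
    (forall a b, cop a b -> a \in F -> b \in F) ->
    {in F, forall b, spanned (cls b)} -> spanned F.
Proof.
move: {-1}#|F| (leqnn #|F|) => n; elim: n F => [|n IHn] F leF Fcop Fspan.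
  move: leF; rewrite leqn0 cards_eq0 => /eqP->.
  have -> : rowv (incid R (@set0 Ed)) = 0 by apply/rowP => i; rewrite !mxE ffunE inE.
  exact: sub0mx.
case: (set_0Vmem F) => [F0|[b bF]]; first by apply: IHn => //; rewrite F0 cards0.
have sbF : cls b \subset F.
  by apply/subsetP => a; rewrite in_cop_class => ba; apply: Fcop ba bF.
rewrite (rowv_incidD sbF) addmx_sub ?Fspan //; apply: IHn.
- rewrite -ltnS; apply: leq_trans leF; apply: proper_card.
  apply/properP; split; first exact: subsetDl.
  by exists b => //; rewrite !inE cop_refl.
- move=> a a' aa'; rewrite !inE => /andP[ba aF]; rewrite (Fcop _ _ aa' aF) andbT.
  by apply: contra ba => ba'; apply: (cop_trans card_ends) ba' _; rewrite cop_sym.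
- by move=> a; rewrite inE => /andP[_ /Fspan].
Qed.

Lemma tec_cop_closedD (A B : {set Ed}) : tec A -> tec B ->
  forall a b, cop a b -> a \in B :\: A -> b \in B :\: A.
Proof.
move=> tA tB a b ab; rewrite !inE => /andP[aA aB].
rewrite (tec_edges_cop card_ends tB ab aB) andbT.
by apply: contra aA => bA; apply: (tec_edges_cop card_ends tA) bA; rewrite cop_sym.
Qed.

(** The class of [b] is [F] minus the union of the other classes in [F], which is spanned. *)
Lemma spanned_class_of_rest b (F : {set Ed}) :
    (forall a a', cop a a' -> a \in F -> a' \in F) -> b \in F -> spanned F ->
    (forall a, a \in F -> ~~ cop b a -> spanned (cls a)) -> spanned (cls b).
Proof.
move=> Fcop bF sF rest.
have sbF : cls b \subset F.
  by apply/subsetP => a; rewrite in_cop_class => ba; apply: Fcop ba bF.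
have -> : cls b = F :\: (F :\: cls b) by rewrite setDDr setDv set0U (setIidPr sbF).
apply: spannedD => //; first exact: subsetDl.
apply: spanned_cop_closed => [a a' aa'|a]; rewrite !inE => /andP[ba aF].
  rewrite (Fcop _ _ aa' aF) andbT.
  by apply: contra ba => ba'; apply: (cop_trans card_ends) ba' _; rewrite cop_sym.
exact: rest.
Qed.

Lemma spanned_comp t : t \in T -> spanned (comp C t).
Proof.
move=> tT; apply: rowv_incid_sub; rewrite in_setU1 inE; apply/orP; right.
apply/existsP; exists t; rewrite tT; apply/existsP; exists f.
by rewrite transversal_notin // CE in_cop_class cop_refl eqxx.
Qed.

Lemma spanned_setT : spanned setT.
Proof. by apply: rowv_incid_sub; rewrite in_setU1 eqxx. Qed.

Lemma spanned_comp_class t b : t \in T -> b \in comp C t -> ~~ cop b t -> spanned (cls b).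
Proof.
move=> tT; have ft := transversal_notin tT.
have tC : tec (comp C t) by rewrite CE; apply: comp_edges_tec.
pose N b := comp C t :\: comp (cls b) t.
move: {-1}#|N b| (leqnn #|N b|) => n; elim: n b => [|n IHn] b leN bC bt.
  move: leN; rewrite leqn0 cards_eq0 => /eqP/setP/(_ b).
  by rewrite !inE cop_refl /= -in_comp_edges bC.
have tL := comp_edges_tec card_ends tecG bt.
have tinL : t \in comp (cls b) t by rewrite mem_comp_edges ?in_cop_class.
have sL : spanned (comp (cls b) t).
  apply: rowv_incid_sub; rewrite in_setU1 inE; apply/orP; right.
  by apply/existsP; exists t; rewrite tT; apply/existsP; exists b; rewrite bt bC orbT /=.
(* If L_b contains [f], everything outside L_b lies in the component of [t], so [N b] is the
   complement of L_b in G. Otherwise L_b lies inside that component. Either way [N b] is a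
   difference of nested spanned sets. *)
have sN : spanned (N b).
  case: (boolP (f \in comp (cls b) t)) => fL.
    suff -> : N b = setT :\: comp (cls b) t.
      by apply: spannedD sL; [exact: subsetT | exact: spanned_setT].
    apply/setP => h; rewrite !in_setD in_setT andbT.
    apply: andb_idr => hL; rewrite CE in bC *.
    exact: (comp_edges_outside card_ends tecG bt ft bC fL hL).
  apply: (spannedD _ (spanned_comp tT) sL).
  by rewrite CE; apply: sub_comp_edges.
have NbP : b \in N b by rewrite in_setD bC in_comp_edges in_cop_class cop_refl.
apply: spanned_class_of_rest (NbP) sN _ => [|a aN ba]; first exact: tec_cop_closedD.
move: aN; rewrite in_setD => /andP[aL aC].
have at' : ~~ cop a t by apply: tec_edges_avoid tL aL tinL.
apply: IHn => //; rewrite -ltnS; apply: leq_trans leN; apply: proper_card.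
(* L_b is contained in L_a because it misses [a]; and L_a gains [b] by [comp_edges_grow], so [N a]
   is strictly smaller than [N b]. *)
apply/properP; split.
  apply: setDS; exact: sub_comp_edges.
exists b; first exact: NbP.
by rewrite /N in_setD (comp_edges_grow card_ends tecG bt ba aL).
Qed.

(** The class of a transversal edge [t] is what the other classes leave of its component; [C] is
    what all other classes leave of G. *)
Lemma spanned_class b : spanned (cls b).
Proof.
have notC a : a \notin C -> spanned (cls a).
  move=> aC; have /eqP/cards1P[t tE] := transT.2 a aC.
  have : t \in [set t0 in T | same_comp ends C a t0] by rewrite tE set11.
  rewrite inE => /andP[tT at'].
  have aCt : a \in comp C t by rewrite in_comp_edges aC same_comp_sym.
  have tC : tec (comp C t).
    by rewrite CE; apply: comp_edges_tec => //; apply: transversal_notin.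
  case: (boolP (cop a t)) => [cat|]; last exact: spanned_comp_class.
  apply: (spanned_class_of_rest _ aCt (spanned_comp tT)).
    by move=> x y xy; apply: tec_edges_cop tC xy.
  move=> x xC ax; apply: spanned_comp_class tT xC _; apply: contra ax => xt.
  by apply: (cop_trans card_ends) cat _; rewrite cop_sym.
case: (boolP (b \in C)) => [|/notC//]; rewrite CE in_cop_class => fb.
apply: (@spanned_class_of_rest b setT) => [||//|a _ ba]; rewrite ?inE //.
  exact: spanned_setT.
apply: notC; rewrite CE in_cop_class; apply: contra ba => fa.
by apply: (cop_trans card_ends) fa; rewrite cop_sym.
Qed.

Lemma spanned_TECSP x : TECSP ends x -> (rowv x <= incid_mx R face_sets)%MS.
Proof.
move=> [lam [_ lamtec _ xE]].
have -> : rowv x = \sum_F lam F *: rowv (incid R F).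
  apply/rowP => i; rewrite mxE xE summxE; apply: eq_bigr => F _.
  by rewrite !mxE.
apply: summx_sub => F _; case: (eqVneq (lam F) 0) => [->|/lamtec tF].
  by rewrite scale0r sub0mx.
apply/scalemx_sub/spanned_cop_closed => [a b ab|b _]; last exact: spanned_class.
exact: tec_edges_cop tF ab.
Qed.

(** * Validity on the polytope and the facet *)

Lemma face_value_linear x :
  face_value x = \sum_e ((e \in T)%:R - (#|T|%:R - 1) * (e == f)%:R) * x e.
Proof.
under eq_bigr => e _ do rewrite mulrBl.
rewrite sumrB /face_value; congr (_ - _).
  by rewrite big_mkcond; apply: eq_bigr => e _; case: (e \in T); rewrite ?mul1r ?mul0r.
rewrite (bigD1 f) //= eqxx mulr1 big1 ?addr0 // => e /negPf->.
by rewrite mulr0 mul0r.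
Qed.

Lemma face_value_TECSP x : TECSP ends x -> face_value x <= 1.
Proof.
move=> [lam [lam0 lamtec lam1 xE]].
have -> : face_value x = \sum_F lam F * face_value (incid R F).
  rewrite face_value_linear; under eq_bigr => e _ do rewrite xE mulr_sumr.
  rewrite exchange_big; apply: eq_bigr => F _; rewrite face_value_linear mulr_sumr.
  by apply: eq_bigr => e _; rewrite mulrCA.
rewrite -lam1; apply: ler_sum => F _.
case: (eqVneq (lam F) 0) => [->|/lamtec tF]; first by rewrite mul0r.
by rewrite ler_piMr ?face_value_le.
Qed.

Lemma face_value_facet : defines_facet (TECSP (R := R) ends) face_value 1.
Proof.
apply: (@defines_facet_of_span _ _ _ _ _ face_sets face_value_linear).
- exact: face_value_TECSP.
(* The origin comes from the empty subgraph. *)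
- have -> : 0 = incid R set0 :> {ffun Ed -> R} by apply/ffunP => e; rewrite !ffunE inE.
  apply: TECSP_incid; exists set0; split; first by move=> e; rewrite inE.
  split; first by move=> u v; rewrite inE.
  by move=> e [S [S0 Sn0 _ _]]; move: Sn0; rewrite -subset0 S0.
- move=> F FF; split; last exact: face_sets_value.
  exact/TECSP_incid/face_sets_tec.
- exact: spanned_TECSP.
Qed.

End Face.

Theorem mainTheorem10 (R : realFieldType) (V Ed : finType) (ends : Ed -> {set V})
    (C T : {set Ed}) (f : Ed) :
  simple_graph ends ->
  two_edge_connected ends setT setT ->
  coparallel_class ends C ->
  comp_transversal ends C T ->
  f \in C ->
  defines_facet (TECSP (R := R) ends)
    (fun x : {ffun Ed -> R} => \sum_(t in T) x t - (#|T|%:R - 1) * x f) 1.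
Proof.
move=> [card_ends _] tecG clsC transT fC.
have CE := coparallel_classE card_ends tecG clsC fC.
exact (face_value_facet R card_ends tecG CE transT).
Qed.
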